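(* Any functionally Hausdorff space $X$ has cardinality $|X|\le\max\{\alpha(X),\psi(X)\}$ or $|X|\ge\mathfrak c$. In particular, any analytic functionally Hausdorff space $X$ has cardinality $|X|\in\omega\cup\{\omega,\mathfrak c\}$ (that is, $|X|$ is finite, equal to $\omega$, or equal to $\mathfrak c$).
   Context: $\mathfrak c$ denotes the cardinality of the continuum. A topological space $X$ is functionally Hausdorff if for any distinct points $x,y\in X$ there exists a continuous map $f:X\to[0,1]$ with $f(x)=0$ and $f(y)=1$. A space is Čech-complete if it is Tychonoff and is a $G_\delta$-set in some (equivalently, any) of its compactifications. A topological space is Polish if it is homeomorphic to a separable complete metric space, and a topological space is analytic if it is a continuous image of a Polish space. The Lindelöf number $l(X)$ of a topological space $X$ is the smallest infinite cardinal $\kappa$ such that any open cover of $X$ has a subcover of cardinality not exceeding $\kappa$. The pseudocharacter $\psi(X)$ of a topological space $X$ is the smallest cardinal $\kappa$ such that for any point $x\in X$ the family $\tau_x$ of all open neighborhoods of $x$ contains a subfamily $\mathcal U_x\subset\tau_x$ of cardinality $|\mathcal U_x|\le\kappa$ with $\bigcap\mathcal U_x=\bigcap\tau_x$. For a cardinal $\kappa$, a topological space $X$ is $\kappa$-analytic if $X$ is a continuous image of a Čech-complete space $P$ with $l(P)\le\kappa$. The analyticity $\alpha(X)$ of a topological space $X$ is the smallest cardinal $\kappa$ for which $X$ is $\kappa$-analytic (it is well-defined since every space is a continuous image of a discrete space). *)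

(* Defs.v *)
From HB Require Import structures.
From mathcomp Require Import all_boot all_order all_algebra.
From mathcomp Require Import all_classical all_reals all_analysis.
From mathcomp Require Import borel_hierarchy.

Set Implicit Arguments.
Unset Strict Implicit.
Unset Printing Implicit Defensive.

Import Order.TTheory GRing.Theory Num.Theory.
Import numFieldNormedType.Exports.

Local Open Scope classical_set_scope.
Local Open Scope ring_scope.
Local Open Scope card_scope.

(* Cardinals are represented by types, compared through [#<=]. *)
Definition is_least_card (P : Type -> Prop) (K : Type) : Prop :=
  P K /\ forall L : Type, P L -> [set: K] #<= [set: L].

(* The value [void] is never used when some type satisfies P: see
   [least_cardP]. *)
Definition least_card (P : Type -> Prop) : Type :=
  if pselect (exists K, is_least_card P K) is left h then projT1 (cid h)
  else void.

Definition cardinal_max (K L : Type) : Type :=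
  if [set: K] #<= [set: L] then L else K.

Lemma card_le_inj T U (A : set T) (B : set U) (f : T -> U) :
  {in A &, injective f} -> f @` A `<=` B -> A #<= B.
Proof.
move=> fI fAB; have /card_eqPle[_ h] := inj_card_eq fI.
exact: card_le_trans h (subset_card_le fAB).
Qed.

Lemma least_set_card T (Q : set (set T)) : Q !=set0 ->
  exists2 A, Q A & forall B, Q B -> A #<= B.
Proof.
move=> [A0 QA0].
pose PP (Y : set (set T -> T)) :=
  (forall f B, Y f -> Q B -> B (f B)) /\
  (forall f g B, Y f -> Y g -> Q B -> f B = g B -> f = g).
have [|Y [[Y1 Y2] Ymax]] := @Zorn_bigcup _ PP.
  move=> F FP Ftot; split=> [f B [Z FZ Zf] QB|f g B [Z FZ Zf] [W FW Wg] QB fg].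
    by have [h _] := FP _ FZ; exact: h Zf QB.
  have [ZW|WZ] := Ftot _ _ FZ FW.
    by have [_ h] := FP _ FW; apply: h (ZW _ Zf) Wg QB fg.
  by have [_ h] := FP _ FZ; apply: h Zf (WZ _ Wg) QB fg.
have [[A QA Asurj]|noA] :=
    pselect (exists2 A, Q A & forall t, A t -> exists2 f, Y f & f A = t).
  exists A => // B QB.
  have /choice[g gP] t : exists f, A t -> Y f /\ f A = t.
    have [/Asurj[f Yf fA]|nAt] := pselect (A t); first by exists f.
    by exists (fun=> t).
  apply: (@card_le_inj _ _ _ _ (fun t => g t B)) => [s t|_ [t At <-]].
    rewrite !inE => As At e.
    have [Ygs gsA] := gP _ As; have [Ygt gtA] := gP _ At.
    by rewrite -gsA -gtA (Y2 _ _ _ Ygs Ygt QB e).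
  exact: Y1 (gP _ At).1 QB.
have ex A : Q A -> exists t, A t /\ forall f, Y f -> f A <> t.
  move=> QA; apply: contrapT => nex; apply: noA; exists A => // t At.
  apply: contrapT => nf; apply: nex; exists t; split=> // f Yf fA.
  by apply: nf; exists f.
have [t0 _] := ex _ QA0.
have /choice[h hP] A : exists t, Q A -> A t /\ forall f, Y f -> f A <> t.
  by have [/ex[t tP]|nQA] := pselect (Q A); [exists t|exists t0].
pose Yh := Y `|` [set h].
have Yhsub : Y `<=` Yh by move=> f Yf; left.
exfalso; suff : PP Yh.
  apply: (Ymax Yh); split=> // /(_ h (or_intror erefl)) Yh0.
  exact: (hP _ QA0).2 Yh0 erefl.
split=> [f B [Yf|->] QB|f g B [Yf|->] [Yg|->] QB fg //].
- exact: Y1 Yf QB.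
- exact: (hP _ QB).1.
- exact: Y2 fg.
- by case: ((hP _ QB).2 _ Yf).
- by case: ((hP _ QB).2 _ Yg).
Qed.

Lemma card_le_total K L : [set: K] #<= [set: L] \/ [set: L] #<= [set: K].
Proof.
have KE : range (@inl K L) #= [set: K] by apply: inj_card_eq => ? ? _ _ [].
have LE : range (@inr K L) #= [set: L] by apply: inj_card_eq => ? ? _ _ [].
have [|A AE Amin] := @least_set_card _ [set range (@inl K L); range (@inr K L)].
  by exists (range inl); left.
have /= := Amin _ (or_introl erefl); have /= := Amin _ (or_intror erefl).
move: AE => [->|->] AR AL; [left|right].
  by rewrite -(card_le_eql KE) -(card_le_eqr LE).
by rewrite -(card_le_eql LE) -(card_le_eqr KE).
Qed.

Lemma least_cardP (P : Type -> Prop) :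
  (exists K, P K) -> is_least_card P (least_card P).
Proof.
move=> [K0 PK0].
suff h : exists K, is_least_card P K.
  by rewrite /least_card; case: pselect => // e; exact: (projT2 (cid e)).
pose Q (A : set K0) := exists2 K : Type, P K & A #= [set: K].
have [|A [K PK AK] Amin] := @least_set_card _ Q.
  by exists setT; exists K0 => //; exact: card_eqxx.
exists K; split=> // L PL; rewrite -(card_le_eql AK).
have [K0L|/card_leP[f]] := card_le_total K0 L.
  exact: card_le_trans (card_leT _) K0L.
pose g (l : L) : K0 := val (f (SigSub (mem_set (I : [set: L] l)))).
have gE : range g #= [set: L].
  apply: inj_card_eq => s t _ _ /val_inj /(@inj _ _ _ f).
  by rewrite !inE => /(_ I I) [].
by rewrite -(card_le_eqr gE); apply: Amin; exists L.
Qed.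

Definition functionally_hausdorff (R : realType) (X : topologicalType) : Prop :=
  forall x y : X, x <> y -> exists f : X -> R,
    [/\ continuous f, range f `<=` `[0, 1], f x = 0 & f y = 1].

(* [completely_regular_space] separates points from closed sets by uniformities;
   [uniform_separatorP] turns this into separation by [0, 1]-valued continuous
   functions, for any realType. *)
Definition tychonoff_space (X : topologicalType) : Prop :=
  hausdorff_space X /\ completely_regular_space X.

Definition embedding (X Y : topologicalType) (e : X -> Y) : Prop :=
  injective e /\ @open X = [set e @^-1` V | V in open].

Definition compactification (X Y : topologicalType) (e : X -> Y) : Prop :=
  [/\ compact [set: Y], hausdorff_space Y, embedding e & dense (range e)].

Definition cech_complete (X : topologicalType) : Prop :=
  tychonoff_space X /\
  exists (Y : topologicalType) (e : X -> Y),
    compactification e /\ Gdelta (range e).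

(* The infinity of K is part of the definition of the Lindelof number. *)
Definition lindelof_le (X : topologicalType) (K : Type) : Prop :=
  infinite_set [set: K] /\
  forall C : set (set X), C `<=` open -> \bigcup_(U in C) U = setT ->
    exists D : set (set X),
      [/\ D `<=` C, D #<= [set: K] & \bigcup_(U in D) U = setT].

Definition lindelof_number (X : topologicalType) : Type :=
  least_card (lindelof_le X).

Definition pseudocharacter_le (X : topologicalType) (K : Type) : Prop :=
  forall x : X, exists U : set (set X),
    [/\ U `<=` open_nbhs x, U #<= [set: K] &
        \bigcap_(A in U) A = \bigcap_(A in open_nbhs x) A].

Definition pseudocharacter (X : topologicalType) : Type :=
  least_card (pseudocharacter_le X).

Definition cardinal_analytic (K : Type) (X : topologicalType) : Prop :=
  exists P : topologicalType,
    [/\ cech_complete P, [set: lindelof_number P] #<= [set: K] &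
        exists2 f : P -> X, continuous f & range f = setT].

Definition analyticity (X : topologicalType) : Type :=
  least_card (cardinal_analytic ^~ X).

(* The library's complete spaces are pointed; [polish_space] is stated on plain
   metric spaces so that the empty space is Polish. *)
Definition polish_space (R : realType) (X : topologicalType) : Prop :=
  exists M : metricType R,
    [/\ forall F : set_system M, ProperFilter F -> cauchy F ->
          exists x : M, F --> x,
        exists2 D : set M, countable D & dense D &
        exists (f : X -> M) (g : M -> X),
          [/\ continuous f, continuous g, cancel f g & cancel g f]].

Definition analytic_space (R : realType) (X : topologicalType) : Prop :=
  exists P : topologicalType,
    polish_space R P /\ exists2 f : P -> X, continuous f & range f = setT.

Lemma lindelof_numberP (X : topologicalType) :
  is_least_card (lindelof_le X) (lindelof_number X).
Proof.
apply: least_cardP; exists (set X + nat)%type; split.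
  apply/infiniteP.
  have E : range (@inr (set X) nat) #= [set: nat].
    by apply: inj_card_eq => ? ? _ _ [].
  by rewrite -(card_le_eql E) card_leT.
move=> C Co CT; exists C; split=> //.
by apply: (@card_le_inj _ _ _ _ inl) => [? ? _ _ []|].
Qed.

Lemma pseudocharacterP (X : topologicalType) :
  is_least_card (pseudocharacter_le X) (pseudocharacter X).
Proof.
apply: least_cardP; exists (set X) => x; exists (open_nbhs x); split=> //.
exact: card_leT.
Qed.

Lemma discrete_cech_complete (R : realType) (X : choiceType) :
  cech_complete (discrete_topology X).
Proof.
set D := discrete_topology X.
have DH : hausdorff_space D by exact: discrete_hausdorff.
split; first by split=> //; exact: (@uniform_completely_regular R).
have [Dfin|Dinf] := pselect (finite_set [set: D]).
  exists D, id; split.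
    split=> //; first exact: finite_compact.
      split=> //; apply/seteqP; split=> [U oU|_ [U oU <-]] //.
      by exists U.
    by move=> O [x Ox] _; exists x; split=> //; exists x.
  exact/open_Gdelta/discrete_open.
exists (one_point_compactification D), Some; split.
  split.
  - exact: one_point_compactification_compact.
  - apply: one_point_compactification_hausdorff => // x _.
    exists [set x]; last by split; [exact: compact_set1|exact: discrete_closed].
    by rewrite withinET; exact: discrete_set1.
  - split=> [x y []//|]; apply/seteqP; split=> [U oU|_ [U oU <-]].
      exists (Some @` U); first exact: one_point_compactification_open_some.
      by apply/seteqP; split=> [x [y Uy [<-]]//|x Ux]; exists x.
    exact: discrete_open.
  - move=> O [[x|] Ox] oO; first by exists (Some x); split=> //; exists x.
    move: oO; rewrite openE => /(_ _ Ox) [C [Ccpt _] CO].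
    have [y nCy] : exists y, ~ C y.
      apply/existsNP => CT.
      pose F : set_system D := [set A | finite_set (~` A)].
      have FF : ProperFilter F.
        split=> [|]; first by rewrite /F/= setC0.
        split=> [|A B|A B AB]; rewrite /F/=.
        - by rewrite setCT.
        - by rewrite setCI finite_setU.
        - by apply: sub_finite_set; exact: subsetC.
      have [|x [_ Fx]] := Ccpt F FF.
        by rewrite /F/= (_ : C = setT) ?setCT//; apply/seteqP; split.
      have [|z [nzx zx]] := Fx (~` [set x]) [set x] _ (discrete_set1 x).
        by rewrite /F/= setCK.
      exact: nzx.
    by exists (Some y); split; [apply: CO; left; exists y|exists y].
apply/open_Gdelta; exact/one_point_compactification_open_some/openT.
Qed.

Lemma analyticityP (R : realType) (X : topologicalType) :
  is_least_card (cardinal_analytic ^~ X) (analyticity X).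
Proof.
apply: least_cardP; exists (lindelof_number (discrete_topology X)).
exists (discrete_topology X); split.
- exact: (discrete_cech_complete R).
- exact: card_lexx.
- exists id; first by move=> x A /nbhs_singleton Ax;
    apply: open_nbhs_nbhs; split=> //; exact: discrete_open.
  by apply/seteqP; split=> // x _; exists x.
Qed.

(* Main.v *)
Require Import Defs.
From mathcomp Require Import all_boot all_order all_algebra.
From mathcomp Require Import all_classical all_reals all_analysis.

(** The theorem is a form of the perfect set theorem.  Let f map a
    Cech-complete space P onto X, and let K bound the Lindelof number of P and
    the pseudocharacter of X.  If X has more than K points, a Cantor scheme is
    built in P: closed sets C_s indexed by finite binary words, each with more
    than K values under f, the two successors of a set having disjoint images.
    Cech-completeness provides a point in the intersection of each branch, and
    these points have distinct images, whence continuum many points of X.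

    A set C_s can be split because it has two points with distinct images all of
    whose neighbourhoods in C_s still have more than K values.  Otherwise, away
    from a single fiber of f, the set C_s would be covered by open sets with at
    most K values each.  The complement of a fiber has Lindelof number at most
    K, being the union of K closed sets by the bound on the pseudocharacter, so
    K of these open sets suffice and C_s has at most K * K = K values.  This is
    [image_dichotomy]; the combinatorial part is [cantor_scheme], and K * K = K
    is [infinite_pairing].

    [image_dichotomy] is stated for a regular space with a complete sequence of
    covers, relatively Lindelof off each fiber.  It therefore applies equally to
    the complete separable metric spaces, with K countable.  An uncountable
    analytic Hausdorff space thus has at least as many points as the Cantor set;
    it has no more, since a point of a Polish space is determined by the basic
    open sets containing it ([polish_card_le]), and the Cantor set has the
    cardinality of the real line ([card_realType]). *)

Set Implicit Arguments.
Unset Strict Implicit.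
Unset Printing Implicit Defensive.

Import Order.TTheory GRing.Theory Num.Theory.
Import numFieldNormedType.Exports.

Local Open Scope classical_set_scope.
Local Open Scope ring_scope.
Local Open Scope card_scope.

(** * Cardinal arithmetic *)

(** The point [u0] is the value of the injection outside [A]; it makes total
    functions available where an injection of subtypes would be painful. *)
Lemma card_le_setP (T U : Type) (A : set T) (B : set U) (u0 : U) :
  A #<= B <->
  exists f : T -> U, (forall x, A x -> B (f x)) /\ {in A &, injective f}.
Proof.
split=> [/card_leP[f]|[f [AB fI]]]; last first.
  by apply: (@card_le_inj _ _ _ _ f) => // _ [x Ax <-]; exact: AB.
exists (fun t => if pselect (A t) is left At
                 then val (f (SigSub (mem_set At))) else u0); split=> [x|x y].
  by case: pselect => // Ax _; apply/set_mem/valP.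
rewrite !inE => Ax Ay; case: pselect => // Ax'; case: pselect => // Ay'.
move=> /val_inj /(@inj _ _ _ f); rewrite !inE => /(_ I I) [].
by [].
Qed.

Lemma card_le_total_set (T U : Type) (A : set T) (B : set U) :
  A #<= B \/ B #<= A.
Proof.
have := card_le_total A B.
by rewrite (card_le_eql (card_setT A)) (card_le_eqr (card_setT B))
  (card_le_eql (card_setT B)) (card_le_eqr (card_setT A)).
Qed.

Lemma infinite_setT_point (K : Type) : infinite_set [set: K] -> K.
Proof. by move=> /infinite_setN0/cid[k]. Qed.

Lemma infinite_setT_inj (K : Type) : infinite_set [set: K] ->
  exists e : nat -> K, injective e.
Proof.
move=> Kinf; move: (Kinf) => /infiniteP.
case/(card_le_setP _ _ (infinite_setT_point Kinf)) => e [_ eI]; exists e => m n.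
by apply: eI; rewrite inE.
Qed.

(** Hessenberg's theorem, K * K <= K.  Zorn's lemma is applied to the graphs of
    pairings A * A -> A on subsets A of K, all containing the graph [G0] of a
    pairing of a countable subset, so that A stays infinite.  If the complement
    of A embeds into A, then K does too and the pairing of A is transported to
    K; otherwise A has a disjoint copy B in its complement, and B is large
    enough to receive the codes of the new pairs of the union of A and B,
    against maximality.  A graph G has domain [dom G], read off its diagonal. *)
Lemma infinite_pairing (K : Type) : infinite_set [set: K] ->
  exists f : K -> K -> K,
    forall a b a' b', f a b = f a' b' -> a = a' /\ b = b'.
Proof.
move=> Kinf; have [e eI] := infinite_setT_inj Kinf.
pose p (m n : nat) : nat := pickle (m, n).
have pI m n m' n' : p m n = p m' n' -> m = m' /\ n = n'.
  by move=> /(pcan_inj pickleK) [].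
pose G0 : set (K * K * K) := [set t | exists m n, t = (e m, e n, e (p m n))].
pose dom (G : set (K * K * K)) : set K := [set a | exists c, G (a, a, c)].
pose Q (G : set (K * K * K)) := [/\
  forall a b c, G (a, b, c) -> [/\ dom G a, dom G b & dom G c],
  forall a b, dom G a -> dom G b -> exists c, G (a, b, c) &
  forall a b a' b' c, G (a, b, c) -> G (a', b', c) -> a = a' /\ b = b'].
have domS G G' : G `<=` G' -> dom G `<=` dom G'.
  by move=> GG' a [c Gc]; exists c; exact: GG'.
have dome G n : G0 `<=` G -> dom G (e n).
  by move=> G0G; exists (e (p n n)); apply: G0G; exists n, n.
have dom0 a : dom G0 a -> exists n, a = e n.
  by move=> [c [m [n [-> _ _]]]]; exists m.
have QG0 : Q G0.
  split.
  - by move=> a b c [m [n [-> -> ->]]]; split; exact: dome.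
  - by move=> a b /dom0[m ->] /dom0[n ->]; exists (e (p m n)), m, n.
  - move=> a b a' b' c [m [n [-> -> ->]]] [m' [n' [-> ->]]].
    by move=> /eI /pI[-> ->].
have [|G [QG Gmax]] := @Zorn_bigcup _ (fun G => Q (G0 `|` G)).
  move=> F FQ Ftot.
  have [->|/set0P[Z0 FZ0]] := eqVneq F set0; first by rewrite bigcup_set0 setU0.
  have G0U Z : F Z -> G0 `|` Z `<=` G0 `|` \bigcup_(X in F) X.
    by move=> FZ; apply: setUS => t Zt; exists Z.
  (* finitely many elements of the union already lie in one member *)
  have in1 t : (G0 `|` \bigcup_(X in F) X) t -> exists2 Z, F Z & (G0 `|` Z) t.
    by move=> [G0t|[Z FZ Zt]]; [exists Z0 => //; left|exists Z => //; right].
  have in2 s t : (G0 `|` \bigcup_(X in F) X) s ->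
      (G0 `|` \bigcup_(X in F) X) t ->
      exists Z, [/\ F Z, (G0 `|` Z) s & (G0 `|` Z) t].
    move=> /in1[Z FZ Zs] /in1[W FW Wt].
    have [ZW|WZ] := Ftot _ _ FZ FW.
      by exists W; split=> //; exact: setUS ZW _ Zs.
    by exists Z; split=> //; exact: setUS WZ _ Wt.
  split.
  - move=> a b c /in1[Z FZ] /=; have [h _ _] := FQ _ FZ.
    by move=> /h[ha hb hc]; split; apply: domS (G0U _ FZ) _ _.
  - move=> a b [c ac] [d bd]; have [Z [FZ Za Zb]] := in2 _ _ ac bd.
    have [_ h _] := FQ _ FZ.
    have [||x Zx] := h a b; [by exists c|by exists d|].
    by exists x; exact: G0U FZ _ Zx.
  - move=> a b a' b' c h1 h2; have [Z [FZ Z1 Z2]] := in2 _ _ h1 h2.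
    by have [_ _ h] := FQ _ FZ; exact: h Z1 Z2.
set H := G0 `|` G in QG; set A := dom H; have [H1 H2 H3] := QG.
have Ae n : A (e n) by apply: dome; exact: subsetUl.
have /choice[h hP] (ab : K * K) : exists c, A ab.1 -> A ab.2 ->
    H (ab.1, ab.2, c).
  have [[Aa Ab]|nA] := pselect (A ab.1 /\ A ab.2).
    by have [c Hc] := H2 _ _ Aa Ab; exists c.
  by exists (e 0) => ? ?; case: nA.
have hA a b : A a -> A b -> A (h (a, b)).
  by move=> Aa Ab; have [] := H1 _ _ _ (hP (a, b) Aa Ab).
have hI a b a' b' : A a -> A b -> A a' -> A b' ->
    h (a, b) = h (a', b') -> a = a' /\ b = b'.
  move=> Aa Ab Aa' Ab' hE; apply: H3 (hP (a, b) Aa Ab) _.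
  by rewrite hE; exact: (hP (a', b')).
have e01 : e 0 <> e 1 by move=> /eI.
(* a set B of size at most |A| can be absorbed, as 2|A| <= |A|^2 <= |A| *)
have absorb (B : set K) (g : K -> K) :
    (forall x, B x -> A (g x)) -> {in B &, injective g} ->
    exists s : K -> K, (forall x, A x \/ B x -> A (s x)) /\
      {in A `|` B &, injective s}.
  move=> BA gI.
  exists (fun x => if pselect (A x) then h (e 0, x) else h (e 1, g x)); split.
    by move=> x; case: pselect => Ax [|] // Bx; apply: hA => //; exact: BA.
  move=> x y; rewrite !inE; case: pselect => Ax; case: pselect => Ay.
  - by move=> _ _ /hI[].
  - by move=> _ [//|/BA ?] /hI[] // /e01.
  - by move=> [//|/BA ?] _ /hI[] // /esym/e01.
  - move=> [//|Bx] [//|By] /hI[||||_] //; [exact: BA|exact: BA|].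
    by apply: gI; rewrite inE.
have [/(card_le_setP _ _ (e 0))[g [CA gI]]|/(card_le_setP _ _ (e 0))[g [AC gI]]]
    := card_le_total_set (~` A) A.
  have [s [sA sI]] := absorb _ g CA gI.
  exists (fun x y => h (s x, s y)) => a b a' b'.
  have sA' x : A (s x) by apply: sA; exact: EM.
  move=> /hI[] // /sI + /sI; rewrite setUv !inE.
  by move=> /(_ I I) -> /(_ I I) ->.
pose B := g @` A.
have /choice[gi giP] b : exists a, B b -> A a /\ g a = b.
  by have [[a Aa <-]|nB] := pselect (B b); [exists a|exists b].
have [|x y|s [sA sI]] := absorb B gi.
- by move=> b /giP[].
- by rewrite !inE => /giP[_ {2}<-] /giP[_ {2}<-] ->.
(* the squares outside A x A get their codes in B = g(A), disjoint from A *)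
pose N : set (K * K * K) := [set t | [/\ (A `|` B) t.1.1, (A `|` B) t.1.2,
  ~ (A t.1.1 /\ A t.1.2) & t.2 = g (h (s t.1.1, s t.1.2))]].
have dH x : dom (H `|` N) x <-> A x \/ B x.
  split=> [[c [Hc|[]//]]|]; first by left; exists c.
  have [[c Hc] _|nAx ABx] := pselect (A x); first by exists c; left.
  by exists (g (h (s x, s x))); right; split=> // -[].
have BN b : B b -> ~ A b by move=> [a Aa <-]; exact: AC.
have Ac x y : A x \/ B x -> A y \/ B y -> A (h (s x, s y)).
  by move=> ABx ABy; apply: hA; exact: sA.
exfalso; apply: (Gmax (G `|` N)).
  split; first by move=> t Gt; left.
  move=> /(_ (g (e 0), g (e 0), g (h (s (g (e 0)), s (g (e 0)))))) h0.
  have Bg : B (g (e 0)) by exists (e 0).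
  apply: (BN _ Bg); exists (g (h (s (g (e 0)), s (g (e 0))))); right.
  by apply: h0; right; split=> /=; [right|right|move=> [/(BN _ Bg)]|].
rewrite setUA -/H; split.
- move=> a b c [/H1[ha hb hc]|[/= ABa ABb _ ->]].
    by split; apply/dH; left.
  split; [exact/dH|exact/dH|apply/dH; right].
  by exists (h (s a, s b)) => //; exact: Ac.
- move=> a b /dH ABa /dH ABb; have [[Aa Ab]|nAB] := pselect (A a /\ A b).
    by have [c Hc] := H2 _ _ Aa Ab; exists c; left.
  by exists (g (h (s a, s b))); right.
- move=> a b a' b' c [Hc|[/= ABa ABb nA cE]] [Hc'|[/= ABa' ABb' nA' cE']].
  + exact: H3 Hc Hc'.
  + have [_ _ Acc] := H1 _ _ _ Hc; exfalso; apply: BN Acc; rewrite cE'.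
    by exists (h (s a', s b')) => //; exact: Ac.
  + have [_ _ Acc] := H1 _ _ _ Hc'; exfalso; apply: BN Acc; rewrite cE.
    by exists (h (s a, s b)) => //; exact: Ac.
  + have /hI[||||/sI sa /sI sb] : h (s a, s b) = h (s a', s b').
      by apply: gI; rewrite ?inE -?cE//; exact: Ac.
    - exact: sA.
    - exact: sA.
    - exact: sA.
    - exact: sA.
    by rewrite sa ?inE// sb ?inE.
Qed.

(** A point of the union is coded by an index and its rank in that member; the
    pairing turns the two codes into one. *)
Lemma card_bigcup_le (I T K : Type) (D : set I) (F : I -> set T) :
  infinite_set [set: K] -> D #<= [set: K] ->
  (forall i, D i -> F i #<= [set: K]) -> \bigcup_(i in D) F i #<= [set: K].
Proof.
move=> Kinf DK FK; have k0 := infinite_setT_point Kinf.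
have [q qI] := infinite_pairing Kinf.
move: DK => /(card_le_setP _ _ k0)[d [_ dI]].
have /choice[f fI] i : exists f : T -> K, D i -> {in F i &, injective f}.
  have [Di|nDi] := pselect (D i); last by exists (fun=> k0).
  by have /(card_le_setP _ _ k0)[f [_ ?]] := FK _ Di; exists f.
have [->|/set0P[i0 _]] := eqVneq D set0; first by rewrite bigcup_set0 card_ge0.
have /choice[i iP] x : exists i, (\bigcup_(i in D) F i) x -> D i /\ F i x.
  have [[i Di Fx]|nx] := pselect ((\bigcup_(i in D) F i) x); first by exists i.
  by exists i0.
apply/(card_le_setP _ _ k0); exists (fun x => q (d (i x)) (f (i x) x)).
split=> // x y; rewrite !inE => /iP[Dx Fx] /iP[Dy Fy] /qI[/dI]; rewrite !inE.
by move=> /(_ Dx Dy) ixy; rewrite -ixy in Dy Fy * => /fI; rewrite !inE; exact.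
Qed.

Lemma card_setU_le (T K : Type) (A B : set T) : infinite_set [set: K] ->
  A #<= [set: K] -> B #<= [set: K] -> A `|` B #<= [set: K].
Proof.
move=> Kinf AK BK.
have := @card_bigcup_le bool T K setT (fun b => if b then A else B) Kinf.
rewrite (_ : \bigcup_(i in setT) _ = A `|` B); last first.
  apply/seteqP; split=> [x [[] _ /=]|x [Ax|Bx]]; [by left|by right| |].
    by exists true.
  by exists false.
apply; last by case.
by apply: card_le_trans; [exact: (@countableP bool)|exact/infiniteP].
Qed.

Lemma card_set1_le (T K : Type) (x : T) : infinite_set [set: K] ->
  [set x] #<= [set: K].
Proof.
move=> /infiniteP; apply: card_le_trans.
exact: countable1.
Qed.

(** * Cantor schemes *)

(** [L] is a class of large sets and [S n] one of sets that are small at level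
    [n].  Splitting each large set in two gives a binary tree of large sets; the
    last hypothesis selects a point in the intersection of every branch, and two
    branches have their points in parts with disjoint images from the level at
    which they separate. *)
Lemma cantor_scheme (T X : Type) (f : T -> X) (L : set (set T))
    (S : nat -> set (set T)) (C0 : set T) :
  L C0 ->
  (forall n C, L C -> exists D : bool -> set T, [/\
    forall b, [/\ L (D b), D b `<=` C & S n (D b)] &
    f @` D true `&` f @` D false = set0]) ->
  (forall C : nat -> set T, (forall n, L (C n)) ->
    (forall n, C n.+1 `<=` C n) -> (forall n, S n (C n.+1)) ->
    exists p, forall n, C n p) ->
  [set: nat -> bool] #<= [set: X].
Proof.
move=> LC0 Lsplit Lbranch.
have /choice[D DP] (nC : nat * set T) : exists D : bool -> set T, L nC.2 ->
    (forall b, [/\ L (D b), D b `<=` nC.2 & S nC.1 (D b)]) /\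
    f @` D true `&` f @` D false = set0.
  have [LC|nLC] := pselect (L nC.2); last by exists (fun=> nC.2).
  by have [D [DL Ddisj]] := Lsplit nC.1 _ LC; exists D.
pose C (s : nat -> bool) := fix C n :=
  if n is m.+1 then D (m, C m) (s m) else C0.
have CL s n : L (C s n).
  by elim: n => //= n /(DP (n, _))[/(_ (s n))[]].
have /choice[p pC] s : exists p, forall n, C s n p.
  by apply: Lbranch => // n; have [/(_ (s n))[]] := DP (n, _) (CL s n).
apply: (@card_le_inj _ _ _ _ (f \o p)) => // s t _ _ /= fpE.
have st n : C s n = C t n -> s n = t n.
  move=> Cn; have [_ disj] := DP (n, _) (CL s n).
  have ps : f (p s) \in f @` D (n, C s n) (s n).
    by apply/mem_set; exists (p s) => //; exact: (pC s n.+1).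
  have pt : f (p s) \in f @` D (n, C s n) (t n).
    by rewrite fpE Cn; apply/mem_set; exists (p t) => //; exact: (pC t n.+1).
  move: ps pt; rewrite !inE; move: disj => /= disj.
  case: (s n); case: (t n) => // h1 h2; exfalso.
    by rewrite -[False]/(set0 (f (p s))) -disj.
  by rewrite -[False]/(set0 (f (p s))) -disj.
have CE n : C s n = C t n by elim: n => //= n IH; rewrite (st _ IH) IH.
by apply/funext => n; exact/st/CE.
Qed.

(** Frolik's complete sequence of covers, in a countable form: sets of the
    class [S n] play the part of the sets of diameter at most 1/n in a complete
    metric space.  Having such a sequence is what Cech-complete spaces and
    complete metric spaces have in common. *)
Definition complete_covers (P : topologicalType) (S : nat -> set (set P)) :=
  [/\ forall n (p : P), exists2 U, nbhs p U & S n U,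
      forall n U V, S n U -> V `<=` U -> S n V &
      forall C : nat -> set P, (forall n, closed (C n)) ->
        (forall n, C n !=set0) -> (forall n, C n.+1 `<=` C n) ->
        (forall n, S n (C n.+1)) -> exists p, forall n, C n p].

(** This isolates what the argument takes from the Lindelof number of P and the
    pseudocharacter of X together.  A countable base of P is another source of
    it, with [K] countable, which serves for Polish spaces. *)
Definition lindelof_off_fibers (P X : topologicalType) (f : P -> X)
    (K : Type) :=
  forall (x : X) (W : set (set P)) (C : set P), W `<=` open -> closed C ->
    C `\` f @^-1` [set x] `<=` \bigcup_(U in W) U ->
    exists W', [/\ W' `<=` W, W' #<= [set: K] &
      C `\` f @^-1` [set x] `<=` \bigcup_(U in W') U].

(** Call a closed set C large when f(C) has more than K points, and a point of C
    small in C when it has a neighbourhood in C with at most K values.  A large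
    C has two points that are not small and have distinct images: otherwise the
    points that are not small would lie in a single fiber, the rest of C would
    be covered by K relatively open sets with at most K values each, and f(C)
    would have at most K points.  Closed neighbourhoods of these two points,
    chosen by regularity, continue the Cantor scheme. *)
Lemma image_dichotomy (P X : topologicalType) (f : P -> X) (K : Type)
    (S : nat -> set (set P)) :
  infinite_set [set: K] -> regular_space P -> hausdorff_space X ->
  continuous f -> complete_covers S -> lindelof_off_fibers f K ->
  range f #<= [set: K] \/ [set: nat -> bool] #<= [set: X].
Proof.
move=> Kinf Preg XH fc [Snbhs Ssub Scomp] lind.
have [|fPK] := pselect (range f #<= [set: K]); [by left|right].
pose small C p := exists U, [/\ open U, U p & f @` (C `&` U) #<= [set: K]].
pose L C := closed C /\ ~ (f @` C #<= [set: K]).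
have LN0 C : L C -> C !=set0.
  move=> [_ nC]; apply/set0P/eqP => C0; apply: nC.
  by rewrite C0 image_set0 card_ge0.
have big2 C : L C -> exists p q,
    [/\ C p, C q, ~ small C p, ~ small C q & f p <> f q].
  move=> LC; have [Cc nC] := LC; apply: contrapT => npq.
  have [x xP] : exists x, forall p, C p -> ~ small C p -> f p = x.
    have [[p [Cp np]]|np] := pselect (exists p, C p /\ ~ small C p).
      exists (f p) => q Cq nq; apply: contrapT => fqp; apply: npq.
      by exists q, p.
    have [p _] := LN0 _ LC; exists (f p) => q Cq nq; exfalso; apply: np.
    by exists q.
  pose W := [set U | open U /\ f @` (C `&` U) #<= [set: K]].
  have [|//|p [Cp /= fpx]|W' [W'W W'K W'C]] := lind x W C.
  - by move=> U [].
  - have [[U [Uo Up UK]]|/(xP _ Cp)//] := pselect (small C p).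
    by exists U.
  apply: nC; apply: (@card_le_trans _ _ _
      ([set x] `|` \bigcup_(U in W') f @` (C `&` U))).
    apply: subset_card_le => _ [p Cp <-].
    have [|fpx] := pselect (f p = x); [by left|right].
    by have [|U W'U Up] := W'C p; [split|exists U => //; exists p].
  apply: card_setU_le => //; first exact: card_set1_le.
  by apply: card_bigcup_le => // U /W'W[].
apply: (@cantor_scheme _ _ f L S setT).
- by split=> //; exact: closedT.
- move=> n C LC; have [p [q [Cp Cq np nq fpq]]] := big2 _ LC.
  move: XH; rewrite open_hausdorff => /(_ (f p) (f q))[|[A B] /=].
    exact/eqP.
  move=> [/set_mem Ap /set_mem Bq] [Ao Bo /eqP AB].
  have shrink r O : C r -> ~ small C r -> nbhs (f r) O ->
      exists D, [/\ L D, D `<=` C, S n D & f @` D `<=` O].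
    move=> Cr nr rO; have [U rU SU] := Snbhs n r.
    have [|V rV VUO] := Preg r (U `&` f @^-1` O).
      by apply: filterI => //; exact: fc.
    exists (C `&` closure V); split.
    + split; first by apply: closedI; [exact: LC.1|exact: closed_closure].
      move=> h; apply: nr; exists V°; split; first exact: open_interior.
        exact: rV.
      apply: card_le_trans h; apply: subset_card_le; apply: image_subset.
      by apply: setIS => x /interior_subset; exact: subset_closure.
    + by move=> x [].
    + by apply: Ssub SU _ => x [_ /VUO[]].
    + by move=> _ [x [_ /VUO[_ Ox]] <-].
  have [|D [LD DC SD DA]] := shrink p A Cp np.
    by apply: open_nbhs_nbhs.
  have [|E [LE EC SE EB]] := shrink q B Cq nq.
    by apply: open_nbhs_nbhs.
  exists (fun b => if b then D else E); split; first by case.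
  by rewrite -subset0 -AB; exact: setISS.
- move=> C CL Cdec CS; apply: Scomp => // n; first by have [] := CL n.
  exact: LN0.
Qed.

(** * Cech-complete spaces of bounded Lindelof number *)

Lemma functionally_hausdorff_hausdorff (R : realType) (X : topologicalType) :
  functionally_hausdorff R X -> hausdorff_space X.
Proof.
move=> fhX; rewrite open_hausdorff => x y /eqP/fhX[f [fc _ fx fy]].
exists (f @^-1` [set r | r < 2^-1], f @^-1` [set r | 2^-1 < r]) => /=.
  by split; apply/mem_set => /=; rewrite ?fx ?fy ?invr_gt0// invf_lt1 ?ltr1n.
split.
- by apply: open_comp => //; exact: open_lt.
- by apply: open_comp => //; exact: open_gt.
- by apply/eqP; rewrite -subset0 => z [/= /lt_trans h /h]; rewrite ltxx.
Qed.

Lemma embedding_continuous (X Y : topologicalType) (e : X -> Y) :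
  embedding e -> continuous e.
Proof.
move=> [_ oE]; apply/continuousP => V oV.
by rewrite oE; exists V.
Qed.

Lemma eventually_in_decreasing (T : Type) (C : nat -> set T) (u : nat -> T) :
  (forall n, C n.+1 `<=` C n) -> (forall n, C n (u n)) ->
  forall n, (u @ \oo) (C n).
Proof.
move=> Cdec uC m; exists m => // n /= mn.
have Cmn : C n `<=` C m.
  elim: n mn => [|n IH]; first by rewrite leqn0 => /eqP ->.
  rewrite leq_eqVlt => /orP[/eqP ->//|]; rewrite ltnS => /IH.
  by apply: subset_trans; exact: Cdec.
exact: Cmn (uC n).
Qed.

(** If the image of P in its compactification Y is the intersection of open sets
    G n, a set is small at level [n] when its closure in Y lies in G n.  For a
    decreasing sequence of such sets, compactness gives a common point of the
    closures in Y, and this point lies in every G n, hence in P. *)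
Lemma cech_complete_covers (P : topologicalType) :
  cech_complete P -> exists S : nat -> set (set P), complete_covers S.
Proof.
move=> [_ [Y [e [[Ycpt YH eemb _] [G Go eG]]]]].
have ec := embedding_continuous eemb; have [_ oE] := eemb.
have Yreg : regular_space Y.
  move=> y; apply: (@compact_regular _ y setT) => //; exact: filterT.
exists (fun n => [set U | closure (e @` U) `<=` G n]); split.
- move=> n p; have [|V epV VG] := Yreg (e p) (G n).
    apply: open_nbhs_nbhs; split=> //.
    have : range e (e p) by exists p.
    by rewrite eG; exact.
  exists (e @^-1` V); first exact: ec.
  apply: subset_trans VG; apply: closureS.
  exact: image_preimage_subset.
- move=> n U V UO VU; apply: subset_trans UO.
  by apply: closureS; exact: image_subset.
- move=> C Cc /choice[u uC] Cdec CO.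
  have [|y [_ ycl]] := Ycpt ((e \o u) @ \oo) _; first exact: filterT.
  have yC n : closure (e @` C n) y.
    move=> B yB; apply: ycl => //.
    apply: (@filterS _ \oo _ (u @^-1` C n)) => [m Cum|]; first by exists (u m).
    exact: eventually_in_decreasing Cdec uC n.
  have [p _ epy] : range e y.
    by rewrite eG => n _; exact: (CO n _ (yC n.+1)).
  exists p => n; apply: contrapT => nCp.
  have : open (~` C n) by rewrite openC.
  rewrite oE => -[V oV VC].
  have [|_ [[q Cq <-] Veq]] := yC n V.
    apply: open_nbhs_nbhs; split=> //; rewrite -epy.
    by rewrite -[V _]/((e @^-1` V) p) VC.
  by move: Veq; rewrite -[V _]/((e @^-1` V) q) VC.
Qed.

(** If V runs over K open neighbourhoods of x with intersection {x}, the
    complement of the fiber over x is the union of the K closed sets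
    f^-1(X - V), each of which inherits the Lindelof number of P. *)
Lemma lindelof_off_fibersP (P X : topologicalType) (f : P -> X) (K L : Type) :
  infinite_set [set: K] -> lindelof_le P L -> [set: L] #<= [set: K] ->
  accessible_space X -> pseudocharacter_le X K -> continuous f ->
  lindelof_off_fibers f K.
Proof.
move=> Kinf [_ PL] LK XT1 Xpsi fc x W C Wo Cc CW.
have [U [Ux UK UI]] := Xpsi x.
have Wx V : U V -> exists D : set (set P), [/\ D `<=` W, D #<= [set: K] &
    C `\` f @^-1` V `<=` \bigcup_(O in D) O].
  move=> UV; have [Vo Vx] := Ux _ UV.
  pose E := ~` (C `\` f @^-1` V).
  have Eo : open E.
    rewrite openC; apply: closedI => //; rewrite closedC.
    by apply: open_comp.
  have [||D [DWE DL DT]] := PL (W `|` [set E]).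
  - by move=> O [/Wo//|->].
  - apply/seteqP; split=> // p _; have [Ep|/contrapT CVp] := pselect (E p).
      by exists E => //; right.
    have [|O WO Op] := CW p; last by exists O => //; left.
    by case: CVp => Cp nVp; split=> // fpx; apply: nVp; rewrite /= fpx.
  exists (D `&` W); split; first by move=> O [].
    apply: card_le_trans (card_le_trans DL LK).
    by apply: subset_card_le => O [].
  move=> p CVp; have : [set: P] p by [].
  rewrite -DT => -[Q DQ Qp]; exists Q => //; split=> //.
  by have [//|QE] := DWE _ DQ; exfalso; move: Qp; rewrite QE; exact.
have /choice[D DP] V : exists D : set (set P), U V -> [/\ D `<=` W,
    D #<= [set: K] & C `\` f @^-1` V `<=` \bigcup_(O in D) O].
  have [/Wx[D DP]|nUV] := pselect (U V); first by exists D.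
  by exists set0.
exists (\bigcup_(V in U) D V); split.
- by move=> O [V /DP[DW _ _] /DW].
- by apply: card_bigcup_le => // V /DP[].
- move=> p [Cp /= fpx].
  have [V UV nVfp] : exists2 V, U V & ~ V (f p).
    apply: contrapT => nV; apply: fpx.
    have : (\bigcap_(A in U) A) (f p).
      by move=> V UV; apply: contrapT => nVfp; apply: nV; exists V.
    rewrite UI => h; apply: contrapT => /eqP; rewrite eq_sym => fpx.
    have [B [Bo /set_mem xB /set_mem nB]] := XT1 _ _ fpx.
    by apply: nB; exact: h.
  have [_ _ DV] := DP _ UV.
  by have [//|O DVO Op] := DV p; exists O => //; exists V.
Qed.

(** * Polish spaces *)

Lemma metric_complete_covers (R : realType) (M : metricType R) :
  (forall F : set_system M, ProperFilter F -> cauchy F ->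
    exists x : M, F --> x) ->
  complete_covers (fun n => [set U : set M |
    exists a, U `<=` ball a n.+1%:R^-1]).
Proof.
move=> Mcomplete; split.
- move=> n p; exists (ball p n.+1%:R^-1); last by exists p.
  by apply: nbhsx_ballx; rewrite invr_gt0.
- by move=> n U V [a Ua] VU; exists a; exact: subset_trans Ua.
- move=> C Cc /choice[u uC] Cdec CS.
  have uCn := eventually_in_decreasing Cdec uC.
  have [|p up] := Mcomplete (u @ \oo) _.
    apply/cauchyP => eps eps0.
    have [n neps] : exists n, n.+1%:R^-1 < eps.
      by have [n _ nP] := near_infty_natSinv_lt (PosNum eps0);
        exists n; exact: (nP n (leqnn n)).
    have [a Ca] := CS n; exists a.
    apply: filterS (uCn n.+1) => x /Ca; apply: le_ball; exact: ltW.
  by exists p => n; exact: (closed_cvg (C n) (Cc n) (uCn n) _ up).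
Qed.

(** The base consists of the balls of radius 1/(n+1) around the points of [D];
    taking their interiors provides open sets by construction. *)
Lemma separable_second_countable (R : realType) (M : metricType R)
    (D : set M) : countable D -> dense D -> @second_countable M.
Proof.
move=> Dcount Ddense.
pose B (dn : M * nat) := (ball dn.1 dn.2.+1%:R^-1)°.
exists (B @` (D `*` setT)).
  apply: card_le_trans (card_image_le _ _) _.
  exact: countableX.
split; first by move=> _ [dn _ <-]; exact: open_interior.
move=> x A /nbhs_ballP[eps /= eps0 xA].
have [n neps] : exists n, n.+1%:R^-1 < eps / 2.
  have eps20 : 0 < eps / 2 by rewrite divr_gt0.
  by have [n _ nP] := near_infty_natSinv_lt (PosNum eps20);
    exists n; exact: (nP n (leqnn n)).
have n0 : 0 < n.+1%:R^-1 / 2 :> R by rewrite divr_gt0// invr_gt0.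
have [d [xd Dd]] : ((ball x (n.+1%:R^-1 / 2))° `&` D) !=set0.
  apply: Ddense; last exact: open_interior.
  by exists x; exact: nbhsx_ballx.
have {}xd := interior_subset xd.
exists (B (d, n)).
  split; first by exists (d, n).
  apply/nbhs_ballP; exists (n.+1%:R^-1 / 2) => //= y xy.
  rewrite (splitr n.+1%:R^-1).
  exact: ball_triangle (ball_sym xd) xy.
move=> y /interior_subset dy; apply: xA; rewrite (splitr eps).
apply: ball_triangle (le_ball (ltW neps) dy).
apply: le_ball xd; apply: le_trans (ltW neps).
by rewrite ler_pdivrMr// ler_peMr// ler1n.
Qed.

Lemma second_countable_lindelof (P X : topologicalType) (f : P -> X) :
  @second_countable P -> lindelof_off_fibers f nat.
Proof.
move=> [B Bcount [Bo Bb]] x W C Wo _ CW.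
have /choice[w wP] b : exists U, (exists2 U, W U & b `<=` U) ->
    W U /\ b `<=` U.
  have [[U WU bU]|nU] := pselect (exists2 U, W U & b `<=` U); first by exists U.
  by exists b.
exists (w @` [set b | B b /\ exists2 U, W U & b `<=` U]); split.
- by move=> _ [b [_ /wP[Wb _]] <-].
- apply: card_le_trans (card_image_le _ _) (card_le_trans _ Bcount).
  by apply: subset_card_le => b [].
- move=> p /CW[U WU Up].
  have [|b [Bb' bp] bU] := Bb p U.
    by apply: open_nbhs_nbhs; split=> //; exact: Wo.
  have /wP[Wb bb] : exists2 U, W U & b `<=` U by exists U.
  exists (w b); last exact: bb.
  by exists b => //; split=> //; exists U.
Qed.

(** A point of a Hausdorff space is determined by the members of a base that
    contain it. *)
Lemma second_countable_card_le (P : topologicalType) :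
  hausdorff_space P -> @second_countable P ->
  [set: P] #<= [set: nat -> bool].
Proof.
move=> PH [B Bcount [Bo Bb]].
move: Bcount => /(card_le_setP _ _ 0%N)[i [_ iI]].
apply: (@card_le_inj _ _ _ _
  (fun (p : P) (n : nat) => `[< exists b, [/\ B b, i b = n & b p] >])) => //.
move=> p q _ _ pq; apply: PH => U V pU qV.
have [b [Bb' bp] bU] := Bb p U pU.
exists q; split; last exact: nbhs_singleton.
have [b' [Bb'' ibb' b'q]] : exists b', [/\ B b', i b' = i b & b' q].
  have /= pqb := congr1 (@^~ (i b)) pq.
  by apply/asboolP; rewrite -pqb; apply/asboolP; exists b.
apply: bU.
by rewrite -(iI b' b) // inE.
Qed.

Lemma polish_image_dichotomy (R : realType) (P X : topologicalType)
    (f : P -> X) : polish_space R P -> hausdorff_space X -> continuous f ->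
  countable (range f) \/ [set: nat -> bool] #<= [set: X].
Proof.
move=> [M [Mcomplete [D Dcount Ddense] [h [g [hc gc hK gK]]]]] XH fc.
have fgc : continuous (f \o g).
  by move=> x; apply: continuous_comp; [exact: gc|exact: fc].
have [|Xcount|] := image_dichotomy infinite_nat (@uniform_regular M) XH fgc
    (metric_complete_covers Mcomplete).
- apply: second_countable_lindelof.
  exact: separable_second_countable Dcount Ddense.
- left; apply: sub_countable Xcount; apply: subset_card_le => _ [p _ <-].
  by exists (h p) => //=; rewrite hK.
- by right.
Qed.

Lemma polish_card_le (R : realType) (P : topologicalType) :
  polish_space R P -> [set: P] #<= [set: nat -> bool].
Proof.
move=> [M [_ [D Dcount Ddense] [h [g [_ _ hK _]]]]].
apply: card_le_trans
  (second_countable_card_le (@metric_hausdorff R M)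
    (separable_second_countable Dcount Ddense)).
apply: (@card_le_inj _ _ _ _ h) => // x y _ _; exact: can_inj hK _ _.
Qed.

Lemma polish_R (R : realType) : polish_space R (R : topologicalType).
Proof.
exists (R^o : metricType R); split.
- by move=> F FF /R_complete/cvg_ex[x Fx]; exists x.
- exists (range ratr); last exact: dense_rat.
  apply: card_le_trans (card_image_le _ _) _.
  exact: countableP.
- by exists id, id; split=> // x; exact: cvg_id.
Qed.

(** The real line is itself Polish, so the dichotomy for Polish spaces applied to
    the identity embeds the Cantor set into it, as the unit interval has positive
    measure and is not countable. *)
Lemma card_realType (R : realType) : [set: R] #= [set: nat -> bool].
Proof.
apply/card_eqPle; split; first exact: polish_card_le (polish_R R).
have [||Rcount|//] := @polish_image_dichotomy R R R id (polish_R R).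
- exact: Rhausdorff.
- by move=> x.
- exfalso; have : lebesgue_measure (`[0, 1]%classic : set R) = 0.
    apply: countable_lebesgue_measure0; apply: sub_countable Rcount.
    by apply: subset_card_le => x _; exists x.
  rewrite lebesgue_measure_itv/= lte_fin ltr01 oppr0 adde0.
  by move=> /eqP; rewrite eqe oner_eq0.
Qed.

(** * The cardinality of functionally Hausdorff spaces *)

Lemma cardinal_max_ge (K L : Type) :
  [set: K] #<= [set: cardinal_max K L] /\ [set: L] #<= [set: cardinal_max K L].
Proof.
rewrite /cardinal_max; case: ifP => [KL|/negP nKL].
  by split=> //; exact: card_lexx.
by split; [exact: card_lexx|have [] := card_le_total K L].
Qed.

Lemma pseudocharacter_le_trans (X : topologicalType) (K L : Type) :
  [set: K] #<= [set: L] -> pseudocharacter_le X K -> pseudocharacter_le X L.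
Proof.
move=> KL XK x; have [U [Ux UK UI]] := XK x.
by exists U; split=> //; exact: card_le_trans KL.
Qed.

Theorem corollary1 (R : realType) (X : topologicalType)
    (fhX : functionally_hausdorff R X) :
  ([set: X] #<= [set: cardinal_max (analyticity X) (pseudocharacter X)] \/
   [set: R] #<= [set: X]) /\
  (analytic_space R X ->
   finite_set [set: X] \/ [set: X] #= [set: nat] \/ [set: X] #= [set: R]).
Proof.
have XH := functionally_hausdorff_hausdorff fhX.
have /card_eqPle[Rle leR] := card_realType R.
split.
  set K := cardinal_max _ _.
  have [aK pK] := cardinal_max_ge (analyticity X) (pseudocharacter X).
  have [[P [Pcech lP [f fc fX]]] _] := analyticityP R X.
  have [[linf _] _] := lindelof_numberP P.
  have lK : [set: lindelof_number P] #<= [set: K] by exact: card_le_trans aK.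
  have Kinf : infinite_set [set: K].
    by apply/infiniteP; apply: card_le_trans lK; exact/infiniteP.
  have [S PS] := cech_complete_covers Pcech.
  have Preg : regular_space P.
    exact: (@completely_regular_regular R P Pcech.1.2).
  have [||] := image_dichotomy Kinf Preg XH fc PS.
  - apply: lindelof_off_fibersP (lK) _ _ _ => //.
    + by have [] := lindelof_numberP P.
    + exact: hausdorff_accessible.
    + apply: pseudocharacter_le_trans pK _.
      by have [] := pseudocharacterP X.
  - by rewrite fX; left.
  - by move=> cX; right; exact: card_le_trans cX.
move=> [P [Ppol [f fc fX]]].
have [|Xinf] := pselect (finite_set [set: X]); [by left|right].
have [|cX] := polish_image_dichotomy Ppol XH fc.
  rewrite fX => Xcount; left; apply/card_eqPle; split=> //.
  exact/infiniteP.
right; apply/card_eqPle; split; last exact: card_le_trans cX.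
rewrite -fX; apply: card_le_trans (card_image_le _ _) _.
exact: card_le_trans (polish_card_le Ppol) leR.
Qed.
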